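(* Let $\mathcal{A}=[a_0,a_1,\ldots,a_{k_1-1}]$ be a binary $(n_1,R_1)$-covering sequence of length $k_1$ and let $\mathcal{B}=[b_0,b_1,\ldots,b_{k_2-1}]$ be a binary $(n_2,R_2)$-covering sequence of length $k_2$, where either $n_1=n_2$ or $n_1=n_2+1$, and $\gcd(k_1,k_2)=1$. Define the cyclic sequence $\mathcal{S}=[s_0,s_1,\ldots,s_{2k_1k_2-1}]$ of length $2k_1k_2$ by $s_{2i}=a_{i \bmod k_1}$ and $s_{2i+1}=b_{i \bmod k_2}$ for $0\le i\le k_1k_2-1$. Then $\mathcal{S}$ is an $(n_1+n_2,R_1+R_2)$-covering sequence of length $2k_1k_2$.
   Context: A cyclic binary sequence $[s_0,\ldots,s_{k-1}]$ of length $k$ has as its windows (consecutive $n$-tuples) the words $(s_i,s_{i+1},\ldots,s_{i+n-1})$, $0\le i\le k-1$, with indices taken modulo $k$. It is an $(n,R)$-covering sequence if for every word $x\in\{0,1\}^n$ there is a window $w$ of length $n$ with Hamming distance $d(x,w)\le R$. *)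

(* Defs.v *)
From mathcomp Require Import all_boot.

Set Implicit Arguments.
Unset Strict Implicit.
Unset Printing Implicit Defensive.

Definition hamming (n : nat) (x y : n.-tuple bool) : nat :=
  #|[set j : 'I_n | tnth x j != tnth y j]|.

(* Indices wrap around modulo k; n may exceed k, so a window can contain the
   whole cyclic sequence several times. *)
Definition window (k : nat) (s : k.-tuple bool) (n i : nat) : n.-tuple bool :=
  [tuple nth false s ((i + j) %% k) | j < n].

Definition covering_sequence (n R k : nat) (s : k.-tuple bool) : Prop :=
  forall x : n.-tuple bool, exists i : 'I_k, hamming x (window s n i) <= R.

(* Main.v *)
(** Interleaving splits both a word and a window starting at an even position
    [2 * i] into an even part, compared with the window of [a] at [i %% k1], and
    an odd part, compared with the window of [b] at [i %% k2].  Since [k1] and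
    [k2] are coprime, [i] can be chosen to reach any pair of positions. *)
Require Import Defs.
From mathcomp Require Import all_boot.

(** Writing the distance as a sum of 0/1 terms indexed through [nth] lets positions be regrouped by
    parity, free of ordinal bounds. *)
Lemma hamming_windowE (n k : nat) (x : n.-tuple bool) (s : k.-tuple bool) i :
  hamming x (window s n i) =
  \sum_(j < n) (nth false x j != nth false s ((i + j) %% k)).
Proof.
rewrite /hamming -sum1_card big_mkcond; apply: eq_bigr => j _.
by rewrite inE tnth_mktuple (tnth_nth false); case: (_ != _).
Qed.

(** The condition on [n1] and [n2] makes them the numbers of even and odd naturals below [n1 + n2].
    Induction on [m] handles equal counts; otherwise one last even term [2 * n2] remains. *)
Lemma sum_even_odd (F : nat -> nat) (n1 n2 : nat) :
  n1 = n2 \/ n1 = n2 + 1 ->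
  \sum_(j < n1 + n2) F j =
  \sum_(j < n1) F (2 * j) + \sum_(j < n2) F (2 * j + 1).
Proof.
have sum_double m : \sum_(j < m + m) F j =
    \sum_(j < m) F (2 * j) + \sum_(j < m) F (2 * j + 1).
  elim: m => [|m IHm]; first by rewrite !big_ord0.
  rewrite addSn addnS !big_ord_recr /= IHm mul2n -addnn addn1.
  by rewrite -addnA addnACA.
case=> -> //; rewrite addn1 addSn !big_ord_recr /= sum_double mul2n -addnn.
by rewrite addnAC.
Qed.

Theorem theorem3 (n1 R1 k1 n2 R2 k2 : nat)
    (a : k1.-tuple bool) (b : k2.-tuple bool)
    (a_cov : covering_sequence n1 R1 a) (b_cov : covering_sequence n2 R2 b)
    (n1_n2 : n1 = n2 \/ n1 = n2 + 1) (gcd_k1_k2 : gcdn k1 k2 = 1)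
    (s : (2 * k1 * k2).-tuple bool)
    (s_even : forall i : nat, i < k1 * k2 ->
      nth false s (2 * i) = nth false a (i %% k1))
    (s_odd : forall i : nat, i < k1 * k2 ->
      nth false s (2 * i + 1) = nth false b (i %% k2)) :
  covering_sequence (n1 + n2) (R1 + R2) s.
Proof.
move=> x.
have [i1 Hi1] := a_cov [tuple nth false x (2 * j) | j < n1].
have [i2 Hi2] := b_cov [tuple nth false x (2 * j + 1) | j < n2].
(* The ordinals [i1] and [i2] rule out empty sequences. *)
have k1_gt0 : 0 < k1 := leq_ltn_trans (leq0n i1) (ltn_ord i1).
have k2_gt0 : 0 < k2 := leq_ltn_trans (leq0n i2) (ltn_ord i2).
have K_gt0 : 0 < k1 * k2 by rewrite muln_gt0 k1_gt0.
have co : coprime k1 k2 by apply/eqP.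
(* Reducing modulo [k1 * k2] makes [2 * i] a legal position of [s] and preserves both residues. *)
pose i := chinese k1 k2 i1 i2 %% (k1 * k2).
have i_k1 : i = i1 %[mod k1] by rewrite modn_dvdm ?dvdn_mulr ?chinese_modl.
have i_k2 : i = i2 %[mod k2] by rewrite modn_dvdm ?dvdn_mull ?chinese_modr.
have lt_i : 2 * i < 2 * k1 * k2 by rewrite -mulnA ltn_pmul2l // ltn_pmod.
exists (Ordinal lt_i); rewrite hamming_windowE.
pose F j := nat_of_bool
  (nth false x j != nth false s ((2 * i + j) %% (2 * k1 * k2))).
rewrite (sum_even_odd F) //.
apply: leq_add; [apply: leq_trans Hi1 | apply: leq_trans Hi2];
  rewrite hamming_windowE; apply/eq_leq/eq_bigr => j _;
  rewrite /F -(tnth_nth false [tuple _ | _ < _]) tnth_mktuple.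
  rewrite -mulnDr -[X in _ %% X]mulnA -muln_modr s_even ?ltn_pmod //.
  by rewrite modn_dvdm ?dvdn_mulr // -modnDml i_k1 modnDml.
(* Since [r < k1 * k2] gives [2 * r + 1 < 2 * (k1 * k2)], the added 1 never causes a wrap-around. *)
have -> : (2 * i + (2 * j + 1)) %% (2 * k1 * k2) =
    2 * ((i + j) %% (k1 * k2)) + 1.
  rewrite addnA -mulnDr {1}(divn_eq (i + j) (k1 * k2)) mulnDr -addnA.
  rewrite mulnCA (mulnA 2 k1) modnMDl modn_small // -mulnA addn1 mul2n.
  by rewrite (mul2n (k1 * k2)) ltn_Sdouble ltn_pmod.
rewrite s_odd ?ltn_pmod //.
by rewrite modn_dvdm ?dvdn_mull // -modnDml i_k2 modnDml.
Qed.
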